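(* Let $F$ be a field of characteristic zero, let $r\ge 2$, and let $P\in F[x]$ be a monic polynomial of degree $r$ whose distinct roots (in an algebraic closure of $F$) are $\alpha_1,\dots,\alpha_s$, with respective multiplicities $m_1,\dots,m_s\ge 1$, so that $\sum_{l=1}^{s}m_l=r$. Assume that $P$ is non-degenerate, i.e. all $\alpha_l$ are nonzero and $\alpha_i/\alpha_j$ is not a root of unity for $i\neq j$. Let $(X_n^{(k)})_{n\ge 0}$, $k=0,\dots,r-1$, be the $r$ impulse sequences of order $r$ associated with $P$. For every integer $n\ge 0$ let $$D=\det\begin{pmatrix} X_{n}^{(1)} & X_{n}^{(2)} & \cdots & X_{n}^{(r-1)}\\ X_{2n}^{(1)} & X_{2n}^{(2)} & \cdots & X_{2n}^{(r-1)}\\ \vdots & \vdots & \ddots & \vdots\\ X_{(r-1)n}^{(1)} & X_{(r-1)n}^{(2)} & \cdots & X_{(r-1)n}^{(r-1)}\end{pmatrix}=\det\left(X_{hn}^{(k)}\right)_{1\le h,k\le r-1}.$$ Then $$D=n^{\sum_{l=1}^{s}\binom{m_l}{2}}\ \prod_{l=1}^{s}\alpha_l^{\binom{m_l}{2}(n-1)}\ \prod_{1\le i<j\le s}\left(\frac{\alpha_j^{n}-\alpha_i^{n}}{\alpha_j-\alpha_i}\right)^{m_im_j}.$$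
   Context: Write $P(x)=x^r-c_1x^{r-1}-\cdots-c_r$. The impulse sequences of order $r$ associated with $P$ are the sequences $(X_n^{(k)})_{n\ge 0}$, $k=0,\dots,r-1$, satisfying the linear recurrence $X^{(k)}_{n+r}=c_1X^{(k)}_{n+r-1}+\cdots+c_rX^{(k)}_{n}$ for all $n\ge 0$, with initial conditions $X_j^{(k)}=\delta_{jk}$ (Kronecker delta) for $j=0,\dots,r-1$. Here $\binom{m}{2}=m(m-1)/2$ (so $\binom{1}{2}=0$), $0^0=1$, and empty products equal $1$. *)

(* Defs.v *)
From HB Require Import structures.
From mathcomp Require Import all_boot all_order all_algebra.

Set Implicit Arguments.
Unset Strict Implicit.
Unset Printing Implicit Defensive.

Import GRing.Theory.
Local Open Scope ring_scope.

(* That [L] is algebraically closed is part of its type. *)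
Definition algebraic_closure (F : fieldType) (L : closedFieldType)
    (iota : {rmorphism F -> L}) : Prop :=
  forall z : L, algebraicOver iota z.

(* The coefficient c_i (1 <= i <= r) when the monic polynomial P of degree r is
   written x^r - c_1 x^(r-1) - ... - c_r. *)
Definition rec_coef (F : fieldType) (r : nat) (P : {poly F}) (i : nat) : F :=
  - P`_(r - i).

(* [X k n] stands for X_n^(k); only the sequences with k < r
   are constrained. *)
Definition impulse_sequences (F : fieldType) (r : nat) (P : {poly F})
    (X : nat -> nat -> F) : Prop :=
  forall k : nat, (k < r)%N ->
    (forall n : nat,
       X k (n + r)%N =
         \sum_(1 <= i < r.+1) rec_coef r P i * X k (n + r - i)%N) /\
    (forall j : nat, (j < r)%N -> X k j = (j == k)%:R).

Definition root_of_1 (L : fieldType) (z : L) : Prop :=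
  exists2 N : nat, (0 < N)%N & N.-unity_root z.

Definition distinct_roots (L : fieldType) (Q : {poly L}) (s : nat)
    (alpha : 'I_s -> L) (m : 'I_s -> nat) : Prop :=
  [/\ injective alpha,
      forall z : L, root Q z <-> exists l : 'I_s, z = alpha l
    & forall l : 'I_s, m l = mup (alpha l) Q].

Definition nondegenerate_roots (L : fieldType) (s : nat) (alpha : 'I_s -> L) : Prop :=
  (forall l : 'I_s, alpha l != 0) /\
  (forall i j : 'I_s, i != j -> ~ root_of_1 (alpha i / alpha j)).

(* Main.v *)
Require Import Defs.
From HB Require Import structures.
From mathcomp Require Import all_boot all_order all_algebra.

Set Implicit Arguments.
Unset Strict Implicit.
Unset Printing Implicit Defensive.

Import GRing.Theory.
Local Open Scope ring_scope.

(** Let [a_0, ..., a_(r-1)] be the roots of [P] in [L], repeated according to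
their multiplicities. The theorem is the case with grouped roots of an
identity in which equal roots need no special treatment:
[[
   D = \prod_(i < k < r) h_n(a_k, a_i),
   h_n(x, y) = (x^n - y^n) / (x - y) = \sum_(i < n) x^(n-1-i) y^i.
]]
Written as a sum, [h_n] makes sense at [x = y], where it is [n x^(n-1)]. A root
[alpha_l] of multiplicity [m_l] therefore contributes
[(n alpha_l^(n-1))^C(m_l, 2)], and two distinct roots contribute the power
[m_i m_j] of the quotient ([pairprod_flatten_nseq]).

To prove the identity, note that [X_N^(k)] is the coefficient of [x^k] in
[x^N mod P] ([expX_modp_impulse]). Since [x^0] has the coefficients
[(1, 0, ..., 0)], adding the row [h = 0] and the column [k = 0] does not change
the determinant ([det_row0]); the enlarged matrix is that of the linear map
[[
   q(y) |-> q(x^n) mod P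
]]
on polynomials of degree less than [r], in the monomial bases. Pass to the
Newton bases [N_k = \prod_(i < k) (x - a_i)] at the target and
[N'_k = \prod_(i < k) (y - a_i^n)] at the source. Both are unitriangular over
the monomials, so again the determinant is unchanged ([det_coef_newton]). Now
[[
   N'_k(x^n) = N_k(x) * \prod_(i < k) h_n(x, a_i),
]]
and multiplying [N_k] by any polynomial [G] gives, modulo [P = N_r],
[G(a_k) N_k] plus a combination of later Newton polynomials
([newton_mul_modp]). In these bases the map is thus triangular, with diagonal
entries [\prod_(i < k) h_n(a_k, a_i)] ([det_coef_expX_modp]). *)

(** * The quotient of differences of powers *)

Definition hsum (R : pzRingType) (n : nat) (x y : R) : R :=
  \sum_(i < n) x ^+ (n.-1 - i) * y ^+ i.

Lemma hsum_diag (R : pzRingType) n (x : R) : hsum n x x = n%:R * x ^+ n.-1.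
Proof.
rewrite /hsum (eq_bigr (fun=> x ^+ n.-1)) => [|i _].
  by rewrite sumr_const card_ord mulr_natl.
by rewrite -exprD subnK // -ltnS (ltn_predK (ltn_ord i)).
Qed.

Lemma hsum_divE (K : fieldType) n (x y : K) :
  x != y -> hsum n x y = (x ^+ n - y ^+ n) / (x - y).
Proof. by rewrite -subr_eq0 => xy; rewrite subrXX mulrC mulKf. Qed.

Lemma horner_hsum (R : comNzRingType) n (x y : R) :
  (hsum n 'X x%:P).[y] = hsum n y x.
Proof.
rewrite /hsum horner_sum; apply: eq_bigr => i _.
by rewrite hornerM !horner_exp hornerX hornerC.
Qed.

(** * Newton polynomials *)

Definition newton (R : nzRingType) (a : nat -> R) (k : nat) : {poly R} :=
  \prod_(i < k) ('X - (a i)%:P).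

Section Newton.
Variables (R : nzRingType) (a : nat -> R).

Lemma newtonS k : newton a k.+1 = newton a k * ('X - (a k)%:P).
Proof. exact: big_ord_recr. Qed.

Lemma newton_monic k : newton a k \is monic.
Proof. exact: monic_prod_XsubC. Qed.

Lemma size_newton k : size (newton a k) = k.+1.
Proof.
elim: k => [|k IHk]; first by rewrite /newton big_ord0 size_poly1.
rewrite newtonS size_Mmonic ?monicXsubC ?IHk ?size_XsubC ?addn2 //.
by rewrite -size_poly_eq0 IHk.
Qed.

End Newton.

(** * The determinant in terms of the roots *)

Definition coef_mx (R : nzRingType) (r : nat) (p : nat -> {poly R}) : 'M[R]_r :=
  \matrix_(i, j) (p i)`_j.

(** Turns a change of basis, or a linear map read in given bases, into a product
of coefficient matrices. *)
Lemma coef_mxM (R : comNzRingType) r (A : 'M[R]_r) (p q : nat -> {poly R}) :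
  (forall i : 'I_r, p i = \sum_j A i j *: q j) ->
  coef_mx r p = A *m coef_mx r q.
Proof.
move=> pE; apply/matrixP => i k; rewrite !mxE pE coef_sum.
by apply: eq_bigr => j _; rewrite coefZ !mxE.
Qed.

Lemma det_coef_newton (R : comNzRingType) (a : nat -> R) r :
  \det (coef_mx r (newton a)) = 1.
Proof.
rewrite det_trig => [|]; last first.
  by apply/is_trig_mxP => i j ij; rewrite mxE nth_default // size_newton.
apply: big1 => i _; rewrite mxE.
by have /monicP := newton_monic a i; rewrite lead_coefE size_newton.
Qed.

(** Writing [G = G(a_k) + (x - a_k) Q] gives
[N_k G = G(a_k) N_k + N_(k+1) Q]; repeat with [N_(k+1) Q] until [N_r], which
vanishes modulo itself. *)
Lemma newton_mul_modp (K : fieldType) (a : nat -> K) r k (G : {poly K}) :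
    (k < r)%N ->
  exists2 t : nat -> K, t k = G.[a k] &
    (newton a k * G) %% newton a r = \sum_(j < r | (k <= j)%N) t j *: newton a j.
Proof.
move=> kr; rewrite -(subnKC kr) addSn; move: (r - k.+1)%N => d {r kr}.
have split k' (H : {poly K}) : exists Q : {poly K},
    newton a k' * H = H.[a k'] *: newton a k' + newton a k'.+1 * Q.
  have /factor_theorem[Q HQ] : root (H - H.[a k']%:P) (a k').
    by rewrite /root !hornerE subrr.
  exists Q; rewrite newtonS -mulrA (mulrC _ Q) -HQ mulrBr mulrC.
  by rewrite -mul_polyC (mulrC (newton _ _)) addrC subrK.
elim: d k G => [|d IHd] k G; have [Q GE] := split k G.
  exists (fun=> G.[a k]) => //; rewrite addn0 GE modpD modp_mulr addr0.
  rewrite modpZl modp_small ?size_newton //.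
  rewrite big_mkcond big_ord_recr /= leqnn big1 ?add0r // => j _.
  by rewrite leqNgt ltn_ord.
have [t _ tE] := IHd k.+1 Q.
exists (fun j => if j == k then G.[a k] else t j); first by rewrite eqxx.
rewrite GE modpD modpZl modp_small ?size_newton ?ltnS ?leq_addr //.
have kr : (k < (k + d.+1).+1)%N by rewrite ltnS leq_addr.
rewrite (bigD1 (Ordinal kr)) //= eqxx; congr (_ + _).
move: tE; rewrite addSnnS => ->; apply: eq_big => [j|j kj].
  by rewrite ltn_neqAle andbC -val_eqE eq_sym.
by rewrite gtn_eqF.
Qed.

(** The matrix of [q(y) |-> q(x^n) mod N_r] in monomial bases is compared with the
one, [T], taken from the Newton basis at the nodes [a_i^n] to the one at the
nodes [a_i]. *)
Lemma det_coef_expX_modp (K : fieldType) (a : nat -> K) r n :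
  \det (coef_mx r (fun h => 'X^(h * n) %% newton a r)) =
    \prod_(k < r) \prod_(i < k) hsum n (a k) (a i).
Proof.
pose b i := a i ^+ n.
pose G k := \prod_(i < k) hsum n 'X (a i)%:P.
have bE k : newton b k \Po 'X^n = newton a k * G k.
  rewrite /newton /G rmorph_prod -big_split /=; apply: eq_bigr => i _.
  by rewrite rmorphB /= comp_polyX comp_polyC -subrXX /b polyC_exp.
(* Row k of T holds the Newton coordinates of the image of N'_k. *)
have /fin_all_exists[t tP] (k : 'I_r) : exists t : nat -> K, t k = (G k).[a k] /\
    (newton a k * G k) %% newton a r = \sum_(j < r | (k <= j)%N) t j *: newton a j.
  by have [t] := newton_mul_modp a (G k) (ltn_ord k); exists t.
pose T : 'M[K]_r := \matrix_(k, j) (if (k <= j)%N then t k j else 0).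
have detT : \det T = \prod_(k < r) \prod_(i < k) hsum n (a k) (a i).
  rewrite -det_tr det_trig => [|]; last first.
    by apply/is_trig_mxP => i j ij; rewrite !mxE leqNgt ij.
  apply: eq_bigr => k _; rewrite !mxE leqnn (tP k).1 horner_prod.
  by apply: eq_bigr => i _; rewrite horner_hsum.
(* Both sides become the coefficient matrix of the images p k of the N'_k. *)
rewrite -detT -[LHS]mul1r -(det_coef_newton b r) -det_mulmx.
rewrite -[RHS]mulr1 -(det_coef_newton a r) -det_mulmx; congr (\det _).
pose p k := (newton b k \Po 'X^n) %% newton a r.
rewrite -(@coef_mxM _ _ _ p) => [|k]; last first.
  rewrite /p comp_polyE size_newton (big_ord_widen _ (fun i : nat =>
    (newton b k)`_i *: ('X^n : {poly K}) ^+ i) (ltn_ord k)).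
  rewrite (big_morph _ (@modpD _ _) (mod0p _)) big_mkcond.
  apply: eq_bigr => i _; rewrite mxE modpZl -exprM mulnC; case: ltnP => // ki.
  by rewrite nth_default ?scale0r // size_newton.
rewrite -(@coef_mxM _ _ _ p) // => k; rewrite /p bE (tP k).2 big_mkcond.
by apply: eq_bigr => j _; rewrite mxE; case: ifP; rewrite ?scale0r.
Qed.

(** * Impulse sequences as remainders *)

(** Modulo [P] the powers of [x] satisfy the recurrence of [P], and the powers
below [r] are their own remainders, which gives the initial conditions. *)
Lemma expX_modp_impulse (F : fieldType) r (P : {poly F}) (X : nat -> nat -> F) :
    P \is monic -> size P = r.+1 -> impulse_sequences r P X ->
  forall N, 'X^N %% P = \sum_(k < r) X k N *: 'X^k.
Proof.
move=> Pmonic Psize HX; elim/ltn_ind => N IHN; have [Nr|rN] := ltnP N r.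
  rewrite modp_small ?size_polyXn ?Psize // (bigD1 (Ordinal Nr)) //=.
  have [_ ->] := HX N Nr; rewrite // eqxx scale1r big1 ?addr0 // => k kN.
  have [_ ->] := HX k (ltn_ord k); rewrite // eq_sym.
  by move: kN; rewrite -val_eqE /= => /negPf ->; rewrite scale0r.
have XE : 'X^N = P * 'X^(N - r)
    + \sum_(1 <= i < r.+1) rec_coef r P i *: ('X^(N - i) : {poly F}).
  have -> : P * 'X^(N - r) = \sum_(i < r.+1) P`_i *: 'X^(N - r + i).
    rewrite -[P in LHS]coefK Psize poly_def mulr_suml; apply: eq_bigr => i _.
    by rewrite -scalerAl -exprD addnC.
  have lead1 : P`_r = 1 by move/monicP: Pmonic; rewrite lead_coefE Psize.
  rewrite (reindex_inj rev_ord_inj) -(big_mkord xpredT (fun i =>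
    P`_(r.+1 - i.+1) *: 'X^(N - r + (r.+1 - i.+1)) : {poly F})).
  rewrite big_nat_recl // subSS subn0 lead1 scale1r subnK // -addrA big_add1 /=.
  rewrite -big_split big_nat big1 ?addr0 // => i /andP[_ ir] /=.
  rewrite /rec_coef subSS addnBA // subnK // scaleNr; exact: subrr.
rewrite XE modpD modp_mulr add0r (big_morph _ (@modpD _ _) (mod0p _)).
transitivity (\sum_(1 <= i < r.+1) rec_coef r P i *:
    \sum_(k < r) X k (N - i)%N *: ('X^k : {poly F})).
  rewrite !big_nat; apply: eq_bigr => i /andP[i0 ir]; rewrite modpZl IHN //.
  by rewrite ltn_subrL i0 (leq_trans _ rN) // (leq_trans i0).
under eq_bigr do rewrite scaler_sumr.
rewrite exchange_big; apply: eq_bigr => k _; have [rec _] := HX k (ltn_ord k).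
rewrite -{2}(subnK rN) rec subnK // scaler_suml.
by apply: eq_bigr => i _; rewrite scalerA.
Qed.

Lemma det_row0 (R : comPzRingType) r (A : 'M[R]_r.+1) :
    (forall j, A ord0 j = (j == ord0)%:R) ->
  \det A = \det (\matrix_(i < r, j < r) A (lift ord0 i) (lift ord0 j)).
Proof.
move=> A0; rewrite (expand_det_row _ ord0) (bigD1 ord0) //= big1 => [|j j0].
  rewrite A0 mul1r addr0 /cofactor expr0 mul1r.
  by congr (\det _); apply/matrixP => i j; rewrite !mxE.
by rewrite A0 (negPf j0) mul0r.
Qed.

(** * Products over pairs of roots *)

(** The product of [f x y] over all pairs of positions in [s], with [x] before
[y]. Recursion on the list lets the roots be counted with multiplicity and split
into blocks of equal roots. *)
Fixpoint pairprod (R : pzSemiRingType) (T : Type) (f : T -> T -> R) (s : seq T) : R :=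
  if s is x :: s' then (\prod_(y <- s') f x y) * pairprod f s' else 1.

Section PairProd.
Variables (R : comPzRingType) (T : Type) (f : T -> T -> R).

Lemma pairprod_cat s1 s2 :
  pairprod f (s1 ++ s2) =
    pairprod f s1 * pairprod f s2 * \prod_(x <- s1) \prod_(y <- s2) f x y.
Proof.
elim: s1 => [|x s1 IHs] /=; first by rewrite big_nil mul1r mulr1.
rewrite IHs big_cat big_cons /= -!mulrA; congr (_ * _); rewrite mulrCA.
by congr (_ * _); rewrite mulrCA.
Qed.

Lemma pairprod_nseq m x : pairprod f (nseq m x) = f x x ^+ 'C(m, 2).
Proof.
elim: m => //= m ->; rewrite big_nseq binS bin1 addnC exprD; congr (_ * _).
by elim: m => //= m ->; rewrite exprS.
Qed.

(** A pair of positions lies either inside the block of one [alpha l], which has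
['C(m l, 2)] pairs, or in two distinct blocks, which have [m i * m j]. *)
Lemma pairprod_flatten_nseq (I : Type) (m : I -> nat) (alpha : I -> T) ls :
  pairprod f (flatten [seq nseq (m l) (alpha l) | l <- ls]) =
    (\prod_(l <- ls) f (alpha l) (alpha l) ^+ 'C(m l, 2)) *
    pairprod (fun i j => f (alpha i) (alpha j) ^+ (m i * m j)) ls.
Proof.
elim: ls => [|l ls IHls] /=; first by rewrite big_nil mul1r.
rewrite pairprod_cat pairprod_nseq IHls big_cons -!mulrA; congr (_ * _).
congr (_ * _); rewrite mulrC; congr (_ * _).
rewrite big_nseq iter_mulr_1 big_flatten big_map -prodrXl.
by apply: eq_bigr => l' _; rewrite big_nseq iter_mulr_1 -exprM mulnC.
Qed.

Lemma pairprod_mkseq r (a : nat -> T) :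
  pairprod f (mkseq a r) = \prod_(k < r) \prod_(i < k) f (a i) (a k).
Proof.
elim: r => [|r IHr]; first by rewrite big_ord0.
rewrite /mkseq -addn1 iotaD map_cat pairprod_cat [pairprod f _]IHr /= add0n.
rewrite big_nil !mulr1 big_map addn1 big_ord_recr /=; congr (_ * _).
rewrite -(big_mkord xpredT (fun i => f (a i) (a r))) /index_iota subn0.
by apply: eq_bigr => i _; rewrite big_seq1.
Qed.

End PairProd.

Lemma pairprod_enum (R : comPzRingType) s (g : 'I_s -> 'I_s -> R) :
  pairprod g (enum 'I_s) = \prod_(i < s) \prod_(j < s | (i < j)%N) g i j.
Proof.
have pairprod_map (T U : Type) (h : T -> U) (f : U -> U -> R) ts :
    pairprod f (map h ts) = pairprod (fun x y => f (h x) (h y)) ts.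
  by elim: ts => //= t ts ->; rewrite big_map.
elim: s g => [|s IHs] g.
  rewrite big_ord0 (_ : enum _ = [::]) //.
  by apply: size0nil; rewrite size_enum_ord.
rewrite enum_ordSl /= pairprod_map IHs big_map big_ord_recl; congr (_ * _).
  rewrite [RHS]big_mkcond big_ord_recl /= mul1r big_enum.
  exact: eq_bigr.
apply: eq_bigr => i _; rewrite [RHS]big_mkcond big_ord_recl /= mul1r.
by rewrite [LHS]big_mkcond.
Qed.

(** * The formula *)

(** A split monic polynomial is determined by the multiplicity of each root, so
its roots may be listed in blocks of equal values. *)
Lemma monic_distinct_rootsE (L : closedFieldType) (Q : {poly L}) s
    (alpha : 'I_s -> L) (m : 'I_s -> nat) :
    Q \is monic -> distinct_roots Q alpha m ->
  Q = \prod_(x <- flatten [seq nseq (m l) (alpha l) | l <- enum 'I_s]) ('X - x%:P).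
Proof.
move=> /monicP Qmonic [alpha_inj Qroots Qmup].
have [rs] := closed_field_poly_normal Q; rewrite Qmonic scale1r => QE.
rewrite {1}QE; apply: perm_big; apply/allP => x _ /=; apply/eqP.
rewrite -(mu_prod_XsubC x rs) -QE count_flatten -map_comp sumnE big_map big_enum.
under eq_bigr do rewrite /= count_nseq.
have [xrt|/mupNroot xNrt] := boolP (root Q x).
  have /Qroots[l ->] := xrt; rewrite (bigD1 l) //= eqxx mul1n Qmup big1 ?addn0 //.
  by move=> i il; rewrite (inj_eq alpha_inj) (negPf il).
rewrite xNrt big1 // => l _ /=.
case: (alpha l =P x) => [xl|_]; last by rewrite mul0n.
by rewrite Qmup xl xNrt muln0.
Qed.

Theorem theorem1 (F : fieldType) (F_char0 : [pchar F] =i pred0)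
    (L : closedFieldType) (iota : {rmorphism F -> L})
    (L_closure : algebraic_closure iota)
    (r : nat) (r_ge2 : (2 <= r)%N)
    (P : {poly F}) (P_monic : P \is monic) (P_deg : size P = r.+1)
    (s : nat) (alpha : 'I_s -> L) (m : 'I_s -> nat)
    (P_roots : distinct_roots (map_poly iota P) alpha m)
    (P_nondeg : nondegenerate_roots alpha)
    (X : nat -> nat -> F) (X_impulse : impulse_sequences r P X)
    (n : nat) :
  iota (\det (\matrix_(h < r.-1, k < r.-1) X k.+1 (h.+1 * n)%N)) =
    n%:R ^+ (\sum_(l < s) 'C(m l, 2))%N
    * (\prod_(l < s) alpha l ^ ('C(m l, 2)%:Z * (n%:Z - 1)))
    * \prod_(i < s) \prod_(j < s | (i < j)%N)
        ((alpha j ^+ n - alpha i ^+ n) / (alpha j - alpha i)) ^+ (m i * m j)%N.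
Proof.
pose Q := map_poly iota P.
pose rs := flatten [seq nseq (m l) (alpha l) | l <- enum 'I_s].
have Q_monic : Q \is monic by rewrite map_monic.
have QE : Q = \prod_(x <- rs) ('X - x%:P) := monic_distinct_rootsE Q_monic P_roots.
have [alpha_inj _ _] := P_roots.
have size_rs : size rs = r.
  by apply: succn_inj; rewrite -(size_prod_XsubC rs id) -QE size_map_poly.
pose a := nth 0 rs.
have rsE : mkseq a r = rs by rewrite -size_rs mkseq_nth.
have QN : Q = newton a r.
  rewrite QE -rsE big_map /newton -(big_mkord xpredT (fun i => 'X - (a i)%:P)).
  by rewrite /index_iota subn0.
transitivity (\det (coef_mx r (fun h => 'X^(h * n) %% newton a r))).
  rewrite -QN -det_map_mx.
  case: r {size_rs rsE QN} r_ge2 P_deg X_impulse => // r _ P_deg X_impulse.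
  have XE h (k : 'I_r.+1) : ('X^h %% Q)`_k = iota (X k h).
    rewrite -(map_polyXn iota) -map_modp (expX_modp_impulse P_monic P_deg X_impulse).
    rewrite coef_map coef_sum (bigD1 k) //= coefZ coefXn eqxx mulr1 big1 ?addr0 //.
    move=> j jk; rewrite coefZ coefXn eq_sym -val_eqE in jk *.
    by rewrite (negPf jk) mulr0.
  rewrite [RHS]det_row0 => [|j].
    by congr (\det _); apply/matrixP => h k; rewrite !mxE XE.
  rewrite mxE modp_small ?coefXn // mul0n size_polyXn.
  by rewrite size_map_poly P_deg.
rewrite det_coef_expX_modp.
transitivity (pairprod (fun x y => hsum n y x) rs).
  by rewrite -rsE pairprod_mkseq.
rewrite pairprod_flatten_nseq pairprod_enum; congr (_ * _); last first.
  apply: eq_bigr => i _; apply: eq_bigr => j ij; congr (_ ^+ _).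
  by rewrite hsum_divE // (inj_eq alpha_inj) -val_eqE gtn_eqF.
rewrite big_enum -prodrXr -big_split; apply: eq_bigr => l _ /=.
(* For n = 0 the exponent n - 1 of alpha l is negative, but the powers of n
   vanish unless 'C(m l, 2) = 0. *)
rewrite hsum_diag exprMn; have [->|n_gt0] := posnP n.
  by case: 'C(_, _) => [|c]; rewrite ?expr0 ?mul0r ?expr0z // expr0n !mul0r.
by congr (_ * _); rewrite subzn // subn1 -PoszM -exprnP -exprM mulnC.
Qed.
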